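(* Let $E$ be a sharply dominating atomic Archimedean lattice effect algebra. Then for every $x\in E$, $x\neq 0$, there exist a unique set of atoms $\{a_\alpha\mid\alpha\in\Lambda\}$ of $E$ (namely $\{a\in E\mid a\text{ an atom of }E,\ a\le x\ominus\widetilde{x}\}$) and unique positive integers $k_\alpha\ne n_{a_\alpha}$ (namely $k_\alpha=\max\{k\in\mathbb{N}\mid k a_\alpha\le x\}$) such that $$x=\widetilde{x}\oplus\Big(\bigoplus\{k_\alpha a_\alpha\mid\alpha\in\Lambda\}\Big).$$ Moreover, $$x=\widetilde{x}\oplus\Big(\bigvee\{k_\alpha a_\alpha\mid\alpha\in\Lambda\}\Big)=\widetilde{x}\vee\Big(\bigvee\{k_\alpha a_\alpha\mid\alpha\in\Lambda\}\Big),$$ $$0=\widetilde{x}\wedge\Big(\bigvee\{k_\alpha a_\alpha\mid\alpha\in\Lambda\}\Big)=\widetilde{x}\wedge\Big(\bigoplus\{k_\alpha a_\alpha\mid\alpha\in\Lambda\}\Big),$$ and $$\widehat{x}=\bigvee\{\widetilde{x}\oplus n_{a_\alpha}a_\alpha\mid\alpha\in\Lambda\}=\widetilde{x}\oplus\Big(\bigvee\{n_{a_\alpha}a_\alpha\mid\alpha\in\Lambda\}\Big)=\widetilde{x}\oplus\Big(\bigoplus\{n_{a_\alpha}a_\alpha\mid\alpha\in\Lambda\}\Big)=\widetilde{x}\vee\Big(\bigvee\{n_{a_\alpha}a_\alpha\mid\alpha\in\Lambda\}\Big),$$ $$0=\widetilde{x}\wedge\Big(\bigvee\{n_{a_\alpha}a_\alpha\mid\alpha\in\Lambda\}\Big)=\widetilde{x}\wedge\Big(\bigoplus\{n_{a_\alpha}a_\alpha\mid\alpha\in\Lambda\}\Big),$$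 and $$\widehat{x}=x\oplus\bigoplus\{(n_{a_\alpha}-k_\alpha)a_\alpha\mid\alpha\in\Lambda\}=x\oplus\Big(\bigvee\{(n_{a_\alpha}-k_\alpha)a_\alpha\mid\alpha\in\Lambda\}\Big).$$
   Context: An effect algebra is a partial algebra $(E;\oplus,0,1)$ with $0\ne 1$ and a partially defined binary operation $\oplus$ such that for all $x,y,z\in E$: (Ei) $x\oplus y=y\oplus x$ if $x\oplus y$ is defined; (Eii) $(x\oplus y)\oplus z=x\oplus(y\oplus z)$ if one side is defined; (Eiii) for every $x$ there is a unique $y$ with $x\oplus y=1$ (write $x'=y$); (Eiv) if $1\oplus x$ is defined then $x=0$. Put $x\le y$ and $y\ominus x=z$ iff $x\oplus z$ is defined and equals $y$; $\le$ is a partial order. $E$ is a lattice effect algebra if $(E,\le)$ is a lattice. For $x\in E$, $\mathrm{ord}(x)=n_x$ is the greatest positive integer $n$ for which $nx=x\oplus\cdots\oplus x$ ($n$ times) exists in $E$, and $\mathrm{ord}(x)=\infty$ if $nx$ exists for every positive integer $n$; in particular $n_a=\mathrm{ord}(a)$ for an atom $a$ of finite order. $E$ is Archimedean if $\mathrm{ord}(x)<\infty$ for all nonzero $x\in E$. An atom is a minimal nonzero element; $E$ is atomic if below every nonzero element there is an atom. Orthogonal sums: a system $G=(x_\kappa)_{\kappa\in H}$ of not necessarily different elements is orthogonal if $\bigoplus K$ (the iterated $\oplus$-sum, with $\bigoplus\emptyset=0$) exists for every finite subsystem $K\subseteq G$; then $\bigoplus G$ exists iff $\bigvee\{\bigoplus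 K\mid K\subseteq G\text{ finite}\}$ exists in $E$, and $\bigoplus G$ equals this supremum. All joins and meets are taken in $E$. Sharp elements: $\mathrm{S}(E)=\{x\in E\mid x\wedge x'=0\}$. $E$ is sharply dominating if for every $x\in E$ there is a smallest sharp element $\widehat{x}\in\mathrm{S}(E)$ with $x\le\widehat{x}$; equivalently, for every $x\in E$ there is a greatest sharp element $\widetilde{x}\in\mathrm{S}(E)$ with $\widetilde{x}\le x$.
   Formalization: The equality x̂ = ⋁{x̃ ⊕ n_a a | α∈Λ} is proved only when Λ is nonempty; for x sharp and nonzero (e.g. x = 1) Λ is empty, the empty join in E is 0, and the equality is false. *)

(* Defs.v *)
From HB Require Import structures.
From mathcomp Require Import all_boot all_order finmap.
From mathcomp Require Import boolp classical_sets.

Set Implicit Arguments.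
Unset Strict Implicit.
Unset Printing Implicit Defensive.

Import Order.Theory.
Local Open Scope order_scope.
Local Open Scope classical_set_scope.

Reserved Notation "x ⊕ y" (at level 50, left associativity).

Declare Scope effect_scope.
Delimit Scope effect_scope with EA.
Local Open Scope effect_scope.

(* The partial operation takes values in [option E]; [None] is "undefined".
   An equation between options is thus a Kleene equality: if one side is
   defined then so is the other, with the same value.  [le_oplus] says that the
   order of the carrier is the one induced by [oplus]; it carries no further
   information, see the factory [isEffectAlgebra] below. *)
HB.mixin Record POrder_isEffectAlgebra (d : Order.disp_t) E
    of Order.POrder d E := {
  ezero : E;
  eone : E;
  oplus : E -> E -> option E;
  ezero_neq_eone : ezero <> eone;
  oplusC : forall x y, oplus x y = oplus y x;
  oplusA : forall x y z,
    obind (fun u => oplus u z) (oplus x y) =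
    obind (fun u => oplus x u) (oplus y z);
  orthosupplement_ex : forall x, exists! y, oplus x y = Some eone;
  oplus1_eq0 : forall x, oplus eone x -> x = ezero;
  le_oplus : forall x y : E, x <= y <-> exists z, oplus x z = Some y
}.

#[short(type="effectAlgType")]
HB.structure Definition EffectAlgebra (d : Order.disp_t) :=
  {E of POrder_isEffectAlgebra d E & Order.POrder d E}.

#[short(type="latticeEffectAlgType")]
HB.structure Definition LatticeEffectAlgebra (d : Order.disp_t) :=
  {E of POrder_isEffectAlgebra d E & Order.Lattice d E}.

(* The axioms of effect algebras alone: the relation [le_oplus] is then always
   a partial order.  Classically, any type is a [choiceType]. *)
HB.factory Record isEffectAlgebra (d : Order.disp_t) E of Choice E := {
  ezero : E;
  eone : E;
  oplus : E -> E -> option E;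
  ezero_neq_eone : ezero <> eone;
  oplusC : forall x y, oplus x y = oplus y x;
  oplusA : forall x y z,
    obind (fun u => oplus u z) (oplus x y) =
    obind (fun u => oplus x u) (oplus y z);
  orthosupplement_ex : forall x, exists! y, oplus x y = Some eone;
  oplus1_eq0 : forall x, oplus eone x -> x = ezero
}.

HB.builders Context d E of isEffectAlgebra d E.

Let le (x y : E) : bool := `[< exists z, oplus x z = Some y >].

Let oplus10 : oplus eone ezero = Some eone.
Proof.
have [z [z1 _]] := orthosupplement_ex eone.
by rewrite -(@oplus1_eq0 z) ?z1.
Qed.

Let oplus0 x : oplus x ezero = Some x.
Proof.
have [y [xy _]] := orthosupplement_ex x; rewrite oplusC in xy.
have [z [yz yU]] := orthosupplement_ex y.
have := oplusA y x ezero; rewrite xy /= oplus10.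
case e: (oplus x ezero) => [u|] //= /esym yu.
by rewrite -(yU _ xy) (yU _ yu).
Qed.

Let cancel x u v y : oplus x u = Some y -> oplus x v = Some y -> u = v.
Proof.
move=> xu xv; have [z [yz _]] := orthosupplement_ex y.
have [w [zw wU]] : exists w, oplus x z = Some w /\
    forall t, oplus x t = Some y -> oplus w t = Some eone.
  have := oplusA u x z; rewrite [oplus u x]oplusC xu /= yz.
  case e: (oplus x z) => [w|] //= uw; exists w; split=> // t xt.
  by have := oplusA t x z; rewrite [oplus t x]oplusC xt /= yz e /= oplusC.
have [s [_ sU]] := orthosupplement_ex w.
by rewrite -(sU u) ?(sU v) //; apply: wU.
Qed.

Let le_refl : reflexive le.
Proof. by move=> x; apply/asboolP; exists ezero. Qed.

Let le_anti : antisymmetric le.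
Proof.
move=> x y /andP[/asboolP[z xz] /asboolP[w yw]].
have := oplusA x z w; rewrite xz /= yw.
case e: (oplus z w) => [u|] //= /esym xu.
have u0 := cancel xu (oplus0 x).
have := oplusA eone z w; rewrite e /= u0 oplus10.
case e1: (oplus eone z) => [v|] //= _.
have z0 : z = ezero by apply: oplus1_eq0; rewrite e1.
by move: xz; rewrite z0 oplus0 => -[].
Qed.

Let le_trans : transitive le.
Proof.
move=> y x z /asboolP[u xu] /asboolP[v yv]; apply/asboolP.
have := oplusA x u v; rewrite xu /= yv.
by case: (oplus u v) => [w|] //= /esym; exists w.
Qed.

HB.instance Definition _ := Order.Le_isPOrder.Build d E le_refl le_anti le_trans.

Let le_oplus (x y : E) : x <= y <-> exists z, oplus x z = Some y.
Proof. by split => [/asboolP|] // ?; apply/asboolP. Qed.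

HB.instance Definition _ := POrder_isEffectAlgebra.Build d E
  ezero_neq_eone oplusC oplusA orthosupplement_ex oplus1_eq0 le_oplus.

HB.end.

Definition the (T : Type) (P : set T) : option T :=
  match pselect (exists x, P x) with
  | left exP => Some (sval (cid exP))
  | right _ => None
  end.

Definition is_greatest d (T : porderType d) (A : set T) : set T :=
  A `&` ubound A.

Definition is_smallest d (T : porderType d) (A : set T) : set T :=
  A `&` lbound A.

Section EffectAlgebraTheory.
Variables (d : Order.disp_t) (E : effectAlgType d).
Implicit Types (x y a : E) (n : nat).

Definition ooplus (u v : option E) : option E :=
  obind (fun x => obind (oplus x) v) u.

Definition orthosupplement x : E := xget ezero [set y | oplus x y = Some eone].

(* equal to [ezero] by convention unless [x <= y] *)
Definition ominus y x : E := xget ezero [set z | oplus x z = Some y].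

Definition multiple n x : option E := iter n (ooplus (Some x)) (Some ezero).

(* [None] stands for infinity: the set below is closed downwards, hence it has
   no greatest element iff all the multiples of [x] exist *)
Definition ord x : option nat :=
  the (is_greatest [set n : nat | (0 < n)%N /\ multiple n x]).

Definition fin_ord x : nat := odflt 0 (ord x).

Definition max_mult x a : nat :=
  odflt 0 (the (is_greatest
    [set k : nat | exists2 y, multiple k a = Some y & y <= x])).

Definition atom : set E :=
  [set a | a <> ezero /\ forall b, b <= a -> b = ezero \/ b = a].

(* Families indexed by [D : set I] are option-valued, so that multiples and
   partial sums can be used directly as terms. *)

Definition partial_sum (I : choiceType) (F : I -> option E) (K : {fset I}) :
  option E := \big[ooplus/Some ezero]_(i <- K) F i.

Definition orthogonal (I : choiceType) (D : set I) (F : I -> option E) :=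
  forall K : {fset I}, [set` K] `<=` D -> partial_sum F K.

Definition orthosum (I : choiceType) (D : set I) (F : I -> option E) :
  option E :=
  the [set s | orthogonal D F /\
    isLub [set y | exists2 K : {fset I},
             [set` K] `<=` D & partial_sum F K = Some y] s].

Definition bigjoin (I : Type) (D : set I) (F : I -> option E) : option E :=
  the [set s | (forall i, D i -> F i) /\
    isLub [set y | exists2 i, D i & F i = Some y] s].

End EffectAlgebraTheory.

Notation "x ⊕ y" := (ooplus x y) : effect_scope.

Definition archimedean d (E : effectAlgType d) :=
  forall x : E, x <> ezero -> ord x.

Definition atomic d (E : effectAlgType d) :=
  forall x : E, x <> ezero -> exists2 a, atom a & a <= x.

Section LatticeEffectAlgebraTheory.
Variables (d : Order.disp_t) (E : latticeEffectAlgType d).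
Implicit Types (x : E) (u v : option E).

Definition sharp : set E := [set x | Order.meet x (orthosupplement x) = ezero].

Definition sharp_above x : set E := sharp `&` [set s | x <= s].
Definition sharp_below x : set E := sharp `&` [set s | s <= x].

Definition sharp_hull x : E := xget x (is_smallest (sharp_above x)).
Definition sharp_core x : E := xget x (is_greatest (sharp_below x)).

Definition ea_join u v : option E := obind (fun x => omap (Order.join x) v) u.
Definition ea_meet u v : option E := obind (fun x => omap (Order.meet x) v) u.

(* The multiplicities [l] matter on [B] only. *)
Definition atomic_decomposition x (B : set E) (l : E -> nat) :=
  [/\ B `<=` @atom d E,
      forall b, B b -> (0 < l b)%N /\ Some (l b) <> ord b &
      Some x = (Some (sharp_core x) ⊕ orthosum B (fun b => multiple (l b) b))%EA].

End LatticeEffectAlgebraTheory.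

Definition sharply_dominating d (E : latticeEffectAlgType d) :=
  forall x : E, exists s, is_smallest (sharp_above x) s.

(* [sharp_hull] and [sharp_core] do not take their default values. *)
Section SharplyDominating.
Variables (d : Order.disp_t) (E : latticeEffectAlgType d).
Implicit Types x y : E.

Lemma orthosupplementP x : oplus x (orthosupplement x) = Some eone.
Proof.
rewrite /orthosupplement; case: xgetP => // /= h.
by have [y [xy _]] := orthosupplement_ex x; case: (h y).
Qed.

Lemma orthosupplementK x : orthosupplement (orthosupplement x) = x.
Proof.
have [y [_ yU]] := orthosupplement_ex (orthosupplement x).
rewrite -(yU _ (orthosupplementP _)); apply: yU.
by rewrite oplusC; apply: orthosupplementP.
Qed.

Lemma orthosupplement_le x y :
  x <= y -> orthosupplement y <= orthosupplement x.
Proof.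
move=> /le_oplus[z xz]; apply/le_oplus; exists z.
have := oplusA x z (orthosupplement y); rewrite xz /= orthosupplementP.
rewrite [oplus z _]oplusC; case: (oplus _ z) => [w|] //= /esym xw.
have [v [_ vU]] := orthosupplement_ex x.
by rewrite -(vU _ xw) -(vU _ (orthosupplementP x)).
Qed.

Lemma sharp_orthosupplement x : sharp x -> sharp (orthosupplement x).
Proof. by rewrite /sharp /= orthosupplementK meetC. Qed.

Hypothesis sdE : sharply_dominating E.

Lemma sharp_hullP x : is_smallest (sharp_above x) (sharp_hull x).
Proof. by rewrite /sharp_hull; case: xgetP => // h; case: (sdE x) => s /h. Qed.

Lemma sharp_coreP x : is_greatest (sharp_below x) (sharp_core x).
Proof.
rewrite /sharp_core; case: xgetP => // h.
have [s [[sS /= xs] smin]] := sdE (orthosupplement x).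
case: (h (orthosupplement s)); split.
  split; first exact: sharp_orthosupplement.
  by rewrite /= -[leRHS]orthosupplementK orthosupplement_le.
move=> t [tS /= tx]; rewrite -[leLHS]orthosupplementK orthosupplement_le //.
apply: smin; split; [exact: sharp_orthosupplement|exact: orthosupplement_le].
Qed.

End SharplyDominating.

(* Main.v *)
Require Import Defs.
From mathcomp Require Import all_boot all_order finmap.
From mathcomp Require Import boolp classical_sets.
Import Order.Theory.
Local Open Scope order_scope.
Local Open Scope classical_set_scope.
Local Open Scope effect_scope.
Set Implicit Arguments.
Unset Strict Implicit.
Unset Printing Implicit Defensive.

(** Write s for the sharp core of x, h for its hull, y = x - s and t = h - s.
    Everything rests on one observation about orthogonal elements that are
    disjoint (that is, whose meet is zero): their sum is their join.  It follows
    that if a is disjoint from z and orthogonal to it, then so is every existing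
    multiple of a (lemma [multiple_orth]): both the multiple already reached
    and z lie below the complement of a, hence so does their sum.

    Consequently n a is sharp when n is the order of the atom a, and sharp
    elements are closed under sums.  So y is meager: no nonzero sharp element
    lies below it, and the greatest multiple k a below y has k < n.  Then y is
    the join of k a and of a remainder disjoint from a; both are orthogonal to
    a, so y itself is orthogonal to each of its atoms ([meager_orth_atom]).
    In particular the atoms below y are pairwise orthogonal, so that finite
    sums of their multiples are joins and infinite sums are least upper bounds
    ([orthosum_disjointP]).

    What remains is to identify three least upper bounds, by looking at an atom
    below the gap left by a hypothetical smaller bound.  For the elements k a
    the bound is y ([lub_max_mult]), since an atom b below the gap would allow
    one more copy of b.  For the elements n a it is t ([lub_fin_ord]), since
    the greatest multiple of b would be a sharp element that can be removed
    from h while keeping it above x.  For the elements (n - k) a it is t - y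
    ([lub_complement]), because adding y leads back to the previous case.

    For uniqueness, consider another decomposition with atoms b and
    multiplicities l.  If an atom a below y did not occur with its full
    multiplicity, then a could be added to every term l b without leaving the
    elements below y; so y, being the join of these terms, would be below y - a
    ([meager_sum_unique]). *)

Local Notation "x ^c" := (orthosupplement x).

(** * Definite descriptions *)

Lemma theP T (P : set T) s : the P = Some s -> P s.
Proof. by rewrite /the; case: pselect => // exP [<-]; case: cid. Qed.

Lemma the_unique T (P : set T) s :
  P s -> (forall t, P t -> t = s) -> the P = Some s.
Proof.
move=> Ps sU; rewrite /the; case: pselect => [exP|[]]; last by exists s.
by case: cid => t /= /sU ->.
Qed.

Lemma isLub_unique d (T : porderType d) (A : set T) s t :
  isLub A s -> isLub A t -> s = t.
Proof. by move=> [As sA] [At tA]; apply/le_anti; rewrite sA ?tA. Qed.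

(** * Partial addition, order and difference *)

Section Lattice.
Variables (d : Order.disp_t) (E : latticeEffectAlgType d).
Implicit Types (a b x y z s t u v w : E) (A D : set E) (m n : nat).
Local Open Scope order_scope.

Lemma oplusAr x y z s t : oplus x y = Some s -> oplus s z = Some t ->
  exists2 r, oplus y z = Some r & oplus x r = Some t.
Proof.
move=> xy sz; have := oplusA x y z; rewrite xy /= sz.
by case: (oplus y z) => //= r /esym; exists r.
Qed.

Lemma oplusAl x y z r t : oplus y z = Some r -> oplus x r = Some t ->
  exists2 s, oplus x y = Some s & oplus s z = Some t.
Proof.
move=> yz xr; have := oplusA x y z; rewrite yz /= xr.
by case: (oplus x y) => //= s; exists s.
Qed.

Lemma orthosupplement_eq x y : oplus x y = Some eone -> y = x^c.
Proof.
have [z [_ zU]] := orthosupplement_ex x.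
by move=> /zU <-; apply: zU; exact: orthosupplementP.
Qed.

Lemma oplusx0 x : oplus x ezero = Some x.
Proof.
have /le_oplus[z xz] := lexx x.
have xcx : oplus x^c x = Some eone by rewrite oplusC orthosupplementP.
have [s] := oplusAl xz xcx; rewrite xcx => -[<-] z1.
by rewrite -[X in oplus _ X](@oplus1_eq0 _ _ z) ?z1.
Qed.

Lemma oplus0x x : oplus ezero x = Some x.
Proof. by rewrite oplusC oplusx0. Qed.

(** Add x and the complement of y to u and to v: both sums are the unit, and
    orthosupplements are unique. *)
Lemma oplusI x u v y : oplus x u = Some y -> oplus x v = Some y -> u = v.
Proof.
move=> xu xv; have ycy : oplus y^c y = Some eone.
  by rewrite oplusC orthosupplementP.
have [s ys su] := oplusAl xu ycy; have [s'] := oplusAl xv ycy.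
by rewrite ys => -[<-] /orthosupplement_eq ->; apply: orthosupplement_eq.
Qed.

Lemma ezero_le x : ezero <= x.
Proof. by apply/le_oplus; exists x; rewrite oplus0x. Qed.

Lemma le_ezero x : x <= ezero -> x = ezero.
Proof. by move=> x0; apply/le_anti; rewrite x0 ezero_le. Qed.

Lemma oplus_lel x y z : oplus x y = Some z -> x <= z.
Proof. by move=> xy; apply/le_oplus; exists y. Qed.

Lemma oplus_ler x y z : oplus x y = Some z -> y <= z.
Proof. by rewrite oplusC => /oplus_lel. Qed.

(** Definedness of sums is thus an order relation, so that joins and
    transitivity apply to it. *)
Lemma oplus_defE x y : oplus x y = (x <= y^c) :> bool.
Proof.
apply/idP/idP.
  case xy: (oplus x y) => [s|] // _; rewrite oplusC in xy.
  have [r xr yr] := oplusAr xy (orthosupplementP s).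
  by rewrite -(orthosupplement_eq yr); exact: oplus_lel xr.
move=> /le_oplus[z xz].
by have [s] := oplusAl xz (orthosupplementP y); rewrite oplusC => ->.
Qed.

Lemma oplus_def x y : x <= y^c -> {z | oplus x y = Some z}.
Proof. by rewrite -oplus_defE; case: oplus => // z _; exists z. Qed.

Lemma le_orthosupplement x y : x <= y^c -> y <= x^c.
Proof. by rewrite -!oplus_defE oplusC. Qed.

Lemma le_oplus2l x y z y' z' : oplus x y = Some z -> oplus x y' = Some z' ->
  (z <= z') = (y <= y').
Proof.
move=> xy xy'; apply/idP/idP => /le_oplus[w].
  move=> zw; have [r yw xr] := oplusAr xy zw.
  by rewrite (oplusI xy' xr); exact: oplus_lel yw.
move=> yw; have [s] := oplusAl yw xy'.
by rewrite xy => -[<-]; exact: oplus_lel.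
Qed.

Lemma ominusP x y : x <= y -> oplus x (ominus y x) = Some y.
Proof.
by move=> /le_oplus[z xz]; rewrite /ominus; case: xgetP => // /(_ z).
Qed.

Lemma ominus_le x y : x <= y -> ominus y x <= y.
Proof. by move=> /ominusP/oplus_ler. Qed.

Lemma ominus_eq0 x y : x <= y -> ominus y x = ezero -> y = x.
Proof. by move=> /ominusP xy y0; move: xy; rewrite y0 oplusx0 => -[]. Qed.

Lemma oplus_leE x y z v : oplus x y = Some z -> x <= v ->
  (z <= v) = (y <= ominus v x).
Proof. by move=> xy /ominusP; exact: le_oplus2l. Qed.

Lemma oplus_mono x y u v z w : u <= x -> v <= y ->
  oplus u v = Some w -> oplus x y = Some z -> w <= z.
Proof.
move=> ux vy uv xy; have [r uy] : {r | oplus u y = Some r}.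
  by apply: oplus_def; rewrite (le_trans ux) // -oplus_defE xy.
apply: (@le_trans _ _ r); first by rewrite (le_oplus2l uv uy).
by rewrite oplusC in uy; rewrite oplusC in xy; rewrite (le_oplus2l uy xy).
Qed.

Lemma ominus_anti x y z : x <= y -> y <= z -> ominus z y <= ominus z x.
Proof.
move=> xy yz; have yz' := ominusP yz.
have [r xr] : {r | oplus x (ominus z y) = Some r}.
  by apply: oplus_def; rewrite (le_trans xy) // -oplus_defE yz'.
rewrite -(oplus_leE xr (le_trans xy yz)).
exact: oplus_mono xy (lexx _) xr yz'.
Qed.

Lemma ooplusA : associative (@ooplus d E).
Proof.
move=> [x|] [y|] [z|] //=; first exact: (esym (oplusA x y z)).
by case: oplus.
Qed.

(** * Multiples and orders *)

Lemma multipleS n x : multiple n.+1 x = Some x ⊕ multiple n x.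
Proof. by []. Qed.

Lemma multipleD m n x : multiple (m + n) x = multiple m x ⊕ multiple n x.
Proof.
elim: m => [|m IH]; first by case: multiple => //= y; rewrite oplus0x.
by rewrite addSn [LHS]multipleS IH ooplusA.
Qed.

Lemma multiple1 x : multiple 1 x = Some x.
Proof. exact: oplusx0. Qed.

Lemma multiple_le m n x q : (m <= n)%N -> multiple n x = Some q ->
  exists2 p, multiple m x = Some p & p <= q.
Proof.
move=> /subnKC <-; rewrite multipleD.
case: (multiple m x) => //= p; case: multiple => //= r pr.
by exists p => //; exact: oplus_lel pr.
Qed.

Lemma le_multiple n x q : (0 < n)%N -> multiple n x = Some q -> x <= q.
Proof. by move=> n0 /(multiple_le n0)[p]; rewrite multiple1 => -[<-]. Qed.

Lemma multiple_neq0 n x q : x <> ezero -> (0 < n)%N -> multiple n x = Some q ->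
  q <> ezero.
Proof. by move=> x0 n0 /(le_multiple n0) + q0; rewrite q0 => /le_ezero. Qed.

Section Archimedean.
Hypothesis E_archimedean : archimedean E.

Lemma ord_fin x : x <> ezero -> ord x = Some (fin_ord x).
Proof. by move=> x0; have := E_archimedean x0; rewrite /fin_ord; case: ord. Qed.

Lemma fin_ordP x : x <> ezero -> is_greatest
  [set n : nat | (0 < n)%N /\ multiple n x] (fin_ord x).
Proof. by move=> x0; exact: theP (ord_fin x0). Qed.

Lemma fin_ord_gt0 x : x <> ezero -> (0 < fin_ord x)%N.
Proof. by move=> /fin_ordP[[]]. Qed.

Lemma multiple_defE n x : x <> ezero ->
  multiple n x = (n <= fin_ord x)%N :> bool.
Proof.
move=> /fin_ordP[[n0]]; case e: multiple => [q|] // _ nU; apply/idP/idP.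
  case: n => // n nx; have := nU n.+1; rewrite leEnat; exact.
by move=> /multiple_le/(_ e)[p ->].
Qed.

Lemma max_multP x a : a <> ezero -> is_greatest
  [set k : nat | exists2 y, multiple k a = Some y & y <= x] (max_mult x a).
Proof.
move=> a0; set P := [set k : nat | _].
have P0 : exists k, `[< P k >].
  by exists 0%N; apply/asboolP; exists ezero => //; exact: ezero_le.
have PU k : `[< P k >] -> (k <= fin_ord a)%N.
  by move=> /asboolP[y ky _]; rewrite -multiple_defE ?ky.
have [k /asboolP Pk kmax] := ex_maxnP P0 PU.
have kG : is_greatest P k.
  by split=> // m Pm; rewrite leEnat kmax //; apply/asboolP.
rewrite /max_mult (the_unique kG) // => t [Pt tG].
by apply/le_anti; rewrite tG // kG.2.
Qed.

Lemma max_mult_le x a k q : a <> ezero -> multiple k a = Some q -> q <= x ->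
  (k <= max_mult x a)%N.
Proof. by move=> a0 kq qx; apply: (max_multP x a0).2; exists q. Qed.

Lemma max_mult_gt0 x a : a <> ezero -> a <= x -> (0 < max_mult x a)%N.
Proof. by move=> a0; apply: (max_mult_le a0 (multiple1 a)). Qed.

End Archimedean.

(** * Disjoint orthogonal elements *)

Lemma disjointS x y u v : u <= x -> v <= y -> x `&` y = ezero ->
  u `&` v = ezero.
Proof. by move=> ux vy xy; apply: le_ezero; rewrite -xy leI2. Qed.

(** The gap w between the join and z would satisfy w + x <= z and w + y <= z;
    by cancellation w is below y and below x. *)
Lemma disjoint_oplusE x y z : x `&` y = ezero -> oplus x y = Some z ->
  z = x `|` y.
Proof.
move=> xy0 xy; have jz : x `|` y <= z.
  by rewrite leUx (oplus_lel xy) (oplus_ler xy).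
apply: (ominus_eq0 jz); have jw := ominusP jz; set w := ominus _ _ in jw *.
apply: le_ezero; rewrite -xy0 lexI; rewrite oplusC in jw.
have jE u : u <= x `|` y -> exists2 v, oplus w u = Some v & v <= z.
  move=> /le_oplus[u' uu']; have [v wu vu'] := oplusAl uu' jw.
  by exists v => //; exact: oplus_lel vu'.
have [v wx] := jE _ (leUl x y); rewrite oplusC in wx.
rewrite (le_oplus2l wx xy) => ->; rewrite andbT.
have [v' wy] := jE _ (leUr y x); rewrite oplusC in wy.
by rewrite oplusC in xy; rewrite (le_oplus2l wy xy).
Qed.

Lemma disjoint_oplus_le x y z v : x `&` y = ezero -> oplus x y = Some z ->
  x <= v -> y <= v -> z <= v.
Proof. by move=> xy0 /(disjoint_oplusE xy0) -> xv yv; rewrite leUx xv. Qed.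

(** Let w be below x and y + z.  It is disjoint from y and orthogonal to it, so
    w + y is their join and stays below y + z; cancelling y gives w <= z. *)
Lemma disjoint_oplus x y z s : oplus y z = Some s -> x <= s^c ->
  x `&` y = ezero -> x `&` z = ezero -> x `&` s = ezero.
Proof.
move=> yz xs xy0 xz0; apply: le_ezero; rewrite -xz0.
set w := x `&` s; have wx : w <= x by exact: leIl.
have ws : w <= s by exact: leIr.
have wyc : w <= y^c.
  rewrite (le_trans wx) // (le_trans xs) //.
  by rewrite orthosupplement_le ?(oplus_lel yz).
have [v wy] := oplus_def wyc.
rewrite oplusC in wy; rewrite lexI wx -(le_oplus2l wy yz); rewrite oplusC in wy.
by apply: (disjoint_oplus_le _ wy ws (oplus_lel yz)); apply: disjointS xy0.
Qed.

(** If q = n a is orthogonal to x and disjoint from it, then q + x is their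
    join; both lie below the complement of a as soon as (n + 1) a exists, hence
    (n + 1) a + x exists. *)
Lemma multiple_orth n a x q : a `&` x = ezero -> a <= x^c ->
  multiple n a = Some q -> q <= x^c /\ q `&` x = ezero.
Proof.
move=> ax0 ax; elim: n q => [|n IH] q /=.
  move=> [<-]; split; first exact: ezero_le.
  by apply: le_ezero; exact: leIl.
case e: multiple => [p|] //= ap; have [px px0] := IH _ e.
have [r pxr] := oplus_def px.
have rac : r <= a^c.
  apply: (disjoint_oplus_le px0 pxr); last exact: le_orthosupplement.
  by rewrite -oplus_defE oplusC ap.
have [v ar] := oplus_def rac; rewrite oplusC in ar.
have [s] := oplusAl pxr ar; rewrite ap => -[<-] qx.
have qxc : q <= x^c by rewrite -oplus_defE qx.
split=> //; rewrite meetC; apply: (disjoint_oplus ap).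
- exact: le_orthosupplement.
- by rewrite meetC.
- by rewrite meetC.
Qed.

(** If w is the meet, each y in A satisfies y + w <= s, because the sum is a
    join; so s <= s - w.  This replaces distributivity, which fails in
    general. *)
Lemma disjoint_lub A s x : isLub A s -> x <= s^c ->
  (forall y, A y -> x `&` y = ezero) -> x `&` s = ezero.
Proof.
move=> [As sA] xs xA; set w := x `&` s.
have ws : w <= s by exact: leIr.
have wx : w <= x by exact: leIl.
have : s <= ominus s w.
  apply: sA => y Ay; have ys := As _ Ay.
  have wyc : w <= y^c.
    by rewrite (le_trans wx) // (le_trans xs) ?orthosupplement_le.
  have [v wy] := oplus_def wyc.
  rewrite -(oplus_leE wy ws); apply: (disjoint_oplus_le _ wy ws ys).
  by apply: disjointS (xA _ Ay).
move=> sw; have := ominusP ws.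
rewrite (_ : ominus s w = s); last by apply/le_anti; rewrite sw ominus_le.
by rewrite oplusC => /oplusI; apply; exact: oplusx0.
Qed.

(** * Sharp and meager elements *)

Lemma sharp_disjoint s x y : sharp s -> x <= s -> y <= s^c -> x `&` y = ezero.
Proof. by move=> sS xs ys; apply: disjointS xs ys sS. Qed.

Lemma sharp_oplus s t r : sharp s -> sharp t -> oplus s t = Some r -> sharp r.
Proof.
move=> sS tS st; rewrite /sharp /=; set w := r `&` r^c.
have wr : w <= r by exact: leIl.
have wrc : w <= r^c by exact: leIr.
have dis u : sharp u -> u <= r -> w `&` u = ezero.
  move=> uS ur; rewrite meetC; apply: sharp_disjoint uS (lexx u) _.
  by rewrite (le_trans wrc) ?orthosupplement_le.
have := disjoint_oplus st wrc (dis s sS (oplus_lel st)).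
by move=> /(_ (dis t tS (oplus_ler st))); rewrite meetC (meet_r wr).
Qed.

Lemma sharp_ominus s t : sharp s -> sharp t -> s <= t -> sharp (ominus t s).
Proof.
move=> sS tS st; have := ominusP st; rewrite oplusC => ts.
have [r sr tr] := oplusAr ts (orthosupplementP t).
rewrite -[ominus t s]orthosupplementK -(orthosupplement_eq tr).
apply/sharp_orthosupplement/(sharp_oplus sS _ sr).
exact: sharp_orthosupplement.
Qed.

Lemma atom_le_or_disjoint a x : atom a -> a <= x \/ a `&` x = ezero.
Proof.
move=> [_ aA]; have [->|e] := aA (a `&` x) (leIl _ _); first by right.
by left; rewrite -e leIr.
Qed.

Lemma atoms_disjoint a b : atom a -> atom b -> a <> b -> a `&` b = ezero.
Proof.
move=> aA [_ bA] ab; have [/bA[a0|//]|//] := atom_le_or_disjoint b aA.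
by case: aA => /(_ a0).
Qed.

(** A sharp s is disjoint from its complement, so the multiples of a remain
    orthogonal to that complement. *)
Lemma sharp_multiple_le s a n q : sharp s -> a <= s ->
  multiple n a = Some q -> q <= s.
Proof.
move=> sS a_s nq; have [] := @multiple_orth n a s^c q _ _ nq.
- exact: sharp_disjoint sS a_s (lexx _).
- by rewrite orthosupplementK.
- by rewrite orthosupplementK.
Qed.

Definition meager x := forall s, sharp s -> s <= x -> s = ezero.

Section ArchimedeanSharp.
Hypothesis E_archimedean : archimedean E.

(** The meet w of q and its complement cannot contain a, for otherwise one more
    multiple of a would exist.  So a is disjoint from w and orthogonal to it,
    and then so is q. *)
Lemma sharp_multiple_ord a q : atom a -> multiple (fin_ord a) a = Some q ->
  sharp q.
Proof.
move=> aA aq; have a0 := aA.1; rewrite /sharp /=; set w := q `&` q^c.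
have wq : w <= q by exact: leIl.
have wqc : w <= q^c by exact: leIr.
have aleq : a <= q by apply: le_multiple aq; exact: fin_ord_gt0.
have aw : a `&` w = ezero.
  have [aw|//] := atom_le_or_disjoint w aA.
  have := multiple_defE E_archimedean (fin_ord a).+1 a0.
  by rewrite ltnn multipleS aq /= oplus_defE (le_trans aw wqc).
have awc : a <= w^c.
  by apply: le_orthosupplement; rewrite (le_trans wqc) ?orthosupplement_le.
by have [_] := multiple_orth aw awc aq; rewrite (meet_r wq).
Qed.

Lemma meager_max_mult_lt y a : meager y -> atom a ->
  (max_mult y a < fin_ord a)%N.
Proof.
move=> yM aA; have a0 := aA.1.
have [[q kq qy] _] := max_multP E_archimedean y a0.
have kn : (max_mult y a <= fin_ord a)%N by rewrite -multiple_defE // kq.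
rewrite ltn_neqAle kn andbT; apply/eqP => kE; rewrite kE in kq.
apply: multiple_neq0 kq (yM _ (sharp_multiple_ord aA kq) qy) => //.
exact: fin_ord_gt0.
Qed.

Lemma max_mult_disjoint y a q : atom a ->
  multiple (max_mult y a) a = Some q -> a `&` ominus y q = ezero.
Proof.
move=> aA kq; have a0 := aA.1.
have [[p kp py] kmax] := max_multP E_archimedean y a0.
have qy : q <= y by move: kp; rewrite kq => -[->].
have [az|//] := atom_le_or_disjoint (ominus y q) aA.
have qz := ominusP qy.
have [r ar] : {r | oplus a q = Some r}.
  by apply: oplus_def; rewrite (le_trans az) // -oplus_defE oplusC qz.
have ry : r <= y by rewrite oplusC in ar; rewrite (oplus_leE ar qy).
suff /kmax : [set k | exists2 u, multiple k a = Some u & u <= y]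
  (max_mult y a).+1 by rewrite leEnat ltnn.
by exists r => //; rewrite multipleS kq.
Qed.

Lemma max_mult_decomposition y a q : atom a -> a <= y ->
  multiple (max_mult y a) a = Some q ->
  [/\ oplus q (ominus y q) = Some y, a `&` ominus y q = ezero &
      a <= (ominus y q)^c].
Proof.
move=> aA ay kq; have a0 := aA.1.
have [[p kp py] _] := max_multP E_archimedean y a0.
have qy : q <= y by move: kp; rewrite kq => -[->].
have qz := ominusP qy; split=> //; first exact: max_mult_disjoint.
apply: (le_trans (le_multiple _ kq)); first exact: max_mult_gt0.
by rewrite -oplus_defE qz.
Qed.

(** Both summands of y = k a + z are orthogonal to a: the first because k + 1 is
    at most the order of a, the second because k a contains a.  Since they are
    disjoint, y is their join. *)
Lemma meager_orth_atom y a : meager y -> atom a -> a <= y -> y <= a^c.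
Proof.
move=> yM aA ay; have a0 := aA.1.
have [[q kq qy] _] := max_multP E_archimedean y a0.
have [qz az zc] := max_mult_decomposition aA ay kq.
have [_ qz0] := multiple_orth az zc kq.
apply: disjoint_oplus_le qz0 qz _ (le_orthosupplement zc).
have := meager_max_mult_lt yM aA; rewrite -(multiple_defE E_archimedean _ a0).
by rewrite multipleS kq /= oplus_defE => /le_orthosupplement.
Qed.

Lemma meager_atoms_orth y a b : meager y -> atom a -> a <= y -> b <= y ->
  b <= a^c.
Proof. by move=> yM aA ay by_; rewrite (le_trans by_) ?meager_orth_atom. Qed.

End ArchimedeanSharp.

(** * Sums of pairwise orthogonal disjoint families *)

Definition values (I : Type) (D : set I) (F : I -> option E) : set E :=
  [set u | exists2 i, D i & F i = Some u].

(** Unlike orthogonality of the family, this is a condition on pairs of terms;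
    disjointness makes it strong enough for all finite sums to exist. *)
Definition disjoint_family (I : Type) (D : set I) (F : I -> option E) :=
  (forall i, D i -> F i) /\
  forall i j u v, D i -> D j -> i <> j -> F i = Some u -> F j = Some v ->
    u <= v^c /\ u `&` v = ezero.

(** A new term is orthogonal to the join p of the earlier ones, and disjoint
    from it by [disjoint_lub]; so the next sum is again a join. *)
Lemma disjoint_sum_lub (I : choiceType) (r : seq I) (F : I -> option E) :
  uniq r -> disjoint_family [set` r] F ->
  exists2 p, \big[@ooplus d E/Some ezero]_(i <- r) F i = Some p &
             isLub (values [set` r] F) p.
Proof.
elim: r => [|i r IH] /=.
  rewrite big_nil; exists ezero => //.
  by split=> [u []|? _] //; exact: ezero_le.
move=> /andP[ir rU] [Fdef Fdis].
have [||p pE pL] := IH.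
- exact: rU.
- split=> [j jr|j k u v jr kr].
    by apply: Fdef; rewrite /= inE; apply/orP; right.
  by apply: Fdis; rewrite /= inE; apply/orP; right.
have [u Fi] : exists u, F i = Some u.
  have := Fdef i; rewrite /= inE eqxx => /(_ isT).
  by case: (F i) => // u; exists u.
have dis v : values [set` r] F v -> u <= v^c /\ u `&` v = ezero.
  move=> [j jr Fj]; apply: Fdis Fi Fj; rewrite /= ?inE ?eqxx //.
    by apply/orP; right.
  by move=> ij; move: ir; rewrite ij jr.
have up : u <= p^c.
  apply: le_orthosupplement; apply: pL.2 => v /dis[uv _].
  exact: le_orthosupplement.
have up0 : u `&` p = ezero by apply: disjoint_lub pL up _ => v /dis[].
have [s us] := oplus_def up.
exists s; first by rewrite big_cons Fi pE.
split=> [v [j]|b bU].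
  rewrite /= inE => /orP[/eqP -> |jr Fj].
    by rewrite Fi => -[<-]; exact: oplus_lel us.
  by rewrite (le_trans _ (oplus_ler us)) //; apply: pL.1; exists j.
apply: disjoint_oplus_le up0 us _ _.
  by apply: bU; exists i => //=; rewrite inE eqxx.
apply: pL.2 => v [j jr Fj]; apply: bU; exists j => //=.
by rewrite inE; apply/orP; right.
Qed.

Lemma big_ooplus_term_le (I : choiceType) (r : seq I) (F : I -> option E) p i :
  \big[@ooplus d E/Some ezero]_(j <- r) F j = Some p -> i \in r ->
  exists2 q, F i = Some q & q <= p.
Proof.
elim: r p => [|j r IH] //= p; rewrite big_cons inE.
case e: (F j) => [u|] //; move: IH.
case: (\big[_/_]_(k <- r) _) => //= v IH uv /predU1P[->|/(IH _ erefl)[q Fi qv]].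
  by exists u => //; exact: oplus_lel uv.
by exists q => //; exact: le_trans qv (oplus_ler uv).
Qed.

Lemma orthosum_term_le (I : choiceType) (D : set I) (F : I -> option E) s i :
  orthosum D F = Some s -> D i -> exists2 q, F i = Some q & q <= s.
Proof.
move=> sE Di; have [FO [sU _]] := theP sE.
have iD : [set` [fset i]%fset] `<=` D by move=> j /=; rewrite inE => /eqP ->.
have := FO _ iD; case e: partial_sum => [p|] // _.
have [|q Fi qp] := big_ooplus_term_le (i := i) e; first by rewrite inE.
by exists q => //; rewrite (le_trans qp) //; apply: sU; exists [fset i]%fset.
Qed.

Lemma orthosum_disjointP (I : choiceType) (D : set I) (F : I -> option E) s :
  disjoint_family D F ->
  orthosum D F = Some s <-> isLub (values D F) s.
Proof.
move=> [Fdef Fdis]; have fin (K : {fset I}) : [set` K] `<=` D ->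
    exists2 p, partial_sum F K = Some p & isLub (values [set` K] F) p.
  move=> KD; apply: disjoint_sum_lub; first exact: fset_uniq.
  by split=> [i /KD|i j u v /KD Di /KD Dj]; [exact: Fdef|exact: Fdis].
have FO : orthogonal D F by move=> K /fin[p ->].
set P := [set y | exists2 K : {fset I},
                    [set` K] `<=` D & partial_sum F K = Some y].
have PV b : ubound P b <-> ubound (values D F) b.
  split=> bU u.
    move=> [i Di Fi]; have KD : [set` [fset i]%fset] `<=` D.
      by move=> j /=; rewrite inE => /eqP ->.
    have [p pE pL] := fin _ KD; apply: (@le_trans _ _ p).
      by apply: pL.1; exists i => //=; rewrite inE.
    by apply: bU; exists [fset i]%fset.
  move=> [K KD]; have [p -> pL] := fin _ KD => -[<-].
  by apply: pL.2 => v [i /KD Di Fi]; apply: bU; exists i.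
have PL t : isLub P t <-> isLub (values D F) t.
  by split=> -[tU tL]; split=> [|b /PV];
    [exact/PV|exact: tL|exact/PV|exact: tL].
split=> [sE|sL]; first by have [_ /PL] := theP sE.
apply: the_unique; first by split=> //; exact/PL.
by move=> t [_ /PL]; move/isLub_unique; apply.
Qed.

Lemma bigjoin_lub (I : Type) (D : set I) (F : I -> option E) s :
  (forall i, D i -> F i) -> isLub (values D F) s -> bigjoin D F = Some s.
Proof.
by move=> Fdef sL; apply: the_unique => // t [_ /isLub_unique]; apply.
Qed.

(** Translation by s preserves joins.  Over an empty index set the join on the
    left would be zero instead of s. *)
Lemma oplus_bigjoin (D : set E) (F : E -> option E) s t r :
  D !=set0 -> oplus s t = Some r -> (forall a, D a -> F a) ->
  isLub (values D F) t -> bigjoin D (fun a => Some s ⊕ F a) = Some r.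
Proof.
move=> [a Da] st Fdef [tU tL].
have sF b w : D b -> F b = Some w -> oplus s w.
  move=> Db Fb; rewrite oplusC oplus_defE (@le_trans _ _ t) //.
    by apply: tU; exists b.
  by rewrite -oplus_defE oplusC st.
apply: bigjoin_lub => [b Db|].
  by have := Fdef b Db; case e: (F b) => [w|] // _; exact: sF Db e.
split=> [u [b Db]|v vU].
  rewrite /=; case e: (F b) => [w|] //= su.
  rewrite (le_oplus2l su st); apply: tU.
  by exists b.
have sFv b w : D b -> F b = Some w -> exists2 u, oplus s w = Some u & u <= v.
  move=> Db Fb; have := sF b w Db Fb; case su: oplus => [u|] // _.
  by exists u => //; apply: vU; exists b => //; rewrite Fb.
have sv : s <= v.
  have := Fdef a Da; case e: (F a) => [w|] // _.
  by have [u /oplus_lel su uv] := sFv _ _ Da e; exact: le_trans su uv.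
rewrite (oplus_leE st sv); apply: tL => w [b Db Fb].
by have [u su] := sFv _ _ Db Fb; rewrite (oplus_leE su sv).
Qed.

(** * Meager elements as joins of multiples of atoms *)

Section AtomicArchimedean.
Hypotheses (E_atomic : atomic E) (E_archimedean : archimedean E).

Definition atoms_below y : set E := [set a | atom a /\ a <= y].

(** An atom b below y - u, where u is a bound below y, would be below y - k b,
    which is disjoint from b by maximality of k. *)
Lemma lub_max_mult y :
  isLub (values (atoms_below y) (fun a => multiple (max_mult y a) a)) y.
Proof.
have kP a (a0 : a <> ezero) := max_multP E_archimedean y a0.
split=> [u [a [aA _] au]|v vU].
  by have [[w]] := kP _ aA.1; rewrite au => -[->].
set u := v `&` y; have uy : u <= y by exact: leIr.
suff -> : y = u by exact: leIl.
apply: (ominus_eq0 uy); apply: contrapT => /E_atomic[b bA bz].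
have b_y : b <= y by rewrite (le_trans bz) ?ominus_le.
have [[q kq qy] _] := kP _ bA.1.
have qu : q <= u by rewrite lexI qy andbT; apply: vU; exists b.
have := max_mult_disjoint E_archimedean bA kq.
rewrite (meet_l (le_trans bz (ominus_anti qu uy))); exact: bA.1.
Qed.

Lemma atoms_multiples_disjoint D (m : E -> nat) : D `<=` @atom d E ->
  (forall a b, D a -> D b -> b <> a -> b <= a^c) ->
  (forall a, D a -> (m a <= fin_ord a)%N) ->
  disjoint_family D (fun a => multiple (m a) a).
Proof.
move=> DA Dorth mn; split=> [a Da|a b u v Da Db ab au bv].
  by rewrite multiple_defE ?mn //; exact: (DA _ Da).1.
have ab0 := atoms_disjoint (DA _ Da) (DA _ Db) ab.
have [ub ub0] := multiple_orth ab0 (Dorth _ _ Db Da ab) au.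
rewrite meetC in ub0.
have [vu vu0] := multiple_orth ub0 (le_orthosupplement ub) bv.
by rewrite meetC; split=> //; exact: le_orthosupplement.
Qed.

Lemma meager_multiples_disjoint y (m : E -> nat) : meager y ->
  (forall a, atoms_below y a -> (m a <= fin_ord a)%N) ->
  disjoint_family (atoms_below y) (fun a => multiple (m a) a).
Proof.
move=> yM; apply: atoms_multiples_disjoint => [a []//|a b [aA ay] [bA by_] _].
exact: meager_atoms_orth yM _ _ _.
Qed.

(** The last hypothesis is how the fact that t comes from a sharp hull enters.
    If b is an atom below t - u for a smaller bound u, then its greatest
    multiple q is orthogonal to every n a, hence to every k a and to y; since q
    is sharp, nonzero and below t, this contradicts that hypothesis. *)
Lemma lub_fin_ord y t : meager y -> sharp t -> y <= t ->
  (forall r, sharp r -> r <= t -> y <= r^c -> r = ezero) ->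
  isLub (values (atoms_below y) (fun a => multiple (fin_ord a) a)) t.
Proof.
move=> yM tS yt tmin; split=> [u [a [aA ay] au]|v vU].
  exact: sharp_multiple_le tS (le_trans ay yt) au.
set u := v `&` t; have ut : u <= t by exact: leIr.
suff -> : t = u by exact: leIl.
apply: (ominus_eq0 ut); apply: contrapT => /E_atomic[b bA bz].
have b0 := bA.1; have bt : b <= t by rewrite (le_trans bz) ?ominus_le.
have buc : b <= u^c.
  by rewrite (le_trans bz) // -oplus_defE oplusC ominusP.
have := multiple_defE E_archimedean (fin_ord b) b0; rewrite leqnn.
case bq: multiple => [q|] // _.
have qS := sharp_multiple_ord E_archimedean bA bq.
apply: (multiple_neq0 b0 (fin_ord_gt0 E_archimedean b0) bq).
apply: (tmin _ qS (sharp_multiple_le tS bt bq)).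
apply: (lub_max_mult y).2 => w [a [aA ay] aw].
have := multiple_defE E_archimedean (fin_ord a) aA.1; rewrite leqnn.
case ap: multiple => [p|] // _.
have wp : w <= p.
  have /ltnW := meager_max_mult_lt E_archimedean yM aA.
  by move=> /multiple_le/(_ ap)[w']; rewrite aw => -[->].
apply: (le_trans wp).
have pu : p <= u.
  rewrite lexI (sharp_multiple_le tS (le_trans ay yt) ap) andbT.
  by apply: vU; exists a.
have bpc : b <= p^c by rewrite (le_trans buc) ?orthosupplement_le.
have bp0 : b `&` p = ezero.
  rewrite meetC; apply: sharp_disjoint (lexx _) bpc.
  exact: sharp_multiple_ord aA ap.
by have [/le_orthosupplement] := multiple_orth bp0 bpc bq.
Qed.

(** With y = k a + z, the element a is disjoint from z and orthogonal to it, so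
    n a + z = (n - k) a + y exists and is a join of elements below t.
    Conversely, if u bounds every (n - k) a, then y + u bounds every
    k a + (n - k) a. *)
Lemma lub_complement y t : meager y -> sharp t -> y <= t ->
  isLub (values (atoms_below y) (fun a => multiple (fin_ord a) a)) t ->
  isLub (values (atoms_below y)
           (fun a => multiple (fin_ord a - max_mult y a)%N a)) (ominus t y).
Proof.
move=> yM tS yt [tU tL].
have nk a : atoms_below y a -> exists q w p,
    [/\ multiple (max_mult y a) a = Some q,
        multiple (fin_ord a - max_mult y a)%N a = Some w,
        multiple (fin_ord a) a = Some p & oplus q w = Some p].
  move=> [aA ay]; have := multiple_defE E_archimedean (fin_ord a) aA.1.
  rewrite leqnn; case ap: multiple => [p|] // _.
  have /ltnW/subnKC := meager_max_mult_lt E_archimedean yM aA.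
  move: ap => + kE; rewrite -{1}kE multipleD.
  case: (multiple (max_mult y a) a) => //= q.
  by case: multiple => //= w qw; exists q, w, p.
have wU : ubound (values (atoms_below y)
    (fun a => multiple (fin_ord a - max_mult y a)%N a)) (ominus t y).
  move=> u [a aD au]; have [q [w [p [aq aw ap qw]]]] := nk a aD.
  have [aA ay] := aD.
  move: aw; rewrite au => -[?]; subst w.
  have [qz az zc] := max_mult_decomposition E_archimedean aA ay aq.
  have [pz pz0] := multiple_orth az zc ap.
  have [r pzr] := oplus_def pz.
  have rt : r <= t.
    apply: disjoint_oplus_le pz0 pzr _ _; first by apply: tU; exists a.
    by rewrite (le_trans _ yt) // (oplus_ler qz).
  rewrite oplusC in qw; have [s qzs us] := oplusAr qw pzr.
  move: qzs; rewrite qz => -[?]; subst s; rewrite oplusC in us.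
  by rewrite -(oplus_leE us yt).
split=> // v vU.
set u := v `&` ominus t y; have ut : u <= ominus t y by exact: leIr.
apply: (@le_trans _ _ u); last exact: leIl.
have yt' := ominusP yt.
have [r yu] : {r | oplus y u = Some r}.
  apply: oplus_def; apply: le_orthosupplement; rewrite (le_trans ut) //.
  by rewrite -oplus_defE oplusC yt'.
rewrite -(le_oplus2l yt' yu); apply: tL => p' [a aD ap'].
have [q [w [p [aq aw ap qw]]]] := nk a aD.
move: ap'; rewrite ap => -[<-]; apply: (oplus_mono _ _ qw yu).
  by apply: (lub_max_mult y).1; exists a.
by rewrite lexI; apply/andP; split; [apply: vU|apply: wU]; exists a.
Qed.

(** As a is disjoint from s and orthogonal to it, a multiple q of a below x
    satisfies q + s <= x, hence q <= y. *)
Lemma max_mult_oplus_sharp s y x a : sharp s -> oplus s y = Some x ->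
  atom a -> a <= y -> max_mult x a = max_mult y a.
Proof.
move=> sS sy aA ay; have a0 := aA.1.
have [[q kq qx] _] := max_multP E_archimedean x a0.
have [[p kp py] _] := max_multP E_archimedean y a0.
apply/eqP; rewrite eqn_leq; apply/andP; split; last first.
  exact: (max_mult_le E_archimedean a0 kp (le_trans py (oplus_ler sy))).
apply: (max_mult_le E_archimedean a0 kq).
have asc : a <= s^c by rewrite (le_trans ay) // -oplus_defE oplusC sy.
have as0 : a `&` s = ezero.
  by rewrite meetC; apply: sharp_disjoint (lexx _) asc.
have [qsc qs0] := multiple_orth as0 asc kq.
have [r qs] := oplus_def qsc.
have rx := disjoint_oplus_le qs0 qs qx (oplus_lel sy).
by rewrite oplusC in qs; rewrite -(le_oplus2l qs sy).
Qed.

(** Were an atom a below y missing, or present with too small a multiplicity,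
    every term q would satisfy a + q <= y: for the terms over other atoms
    because a + q is a join, for the term over a itself because the multiplicity
    leaves room.  Then y <= y - a. *)
Lemma meager_sum_unique y D (l : E -> nat) : meager y -> D `<=` @atom d E ->
  (forall b, D b -> (0 < l b)%N /\ Some (l b) <> ord b) ->
  orthosum D (fun b => multiple (l b) b) = Some y ->
  D = atoms_below y /\ forall a, atoms_below y a -> l a = max_mult y a.
Proof.
move=> yM DA lP DE.
have lb b : D b -> exists2 q, multiple (l b) b = Some q & q <= y.
  exact: orthosum_term_le DE.
have DB : D `<=` atoms_below y.
  move=> b Db; split; first exact: DA.
  have [q bq qy] := lb b Db; apply: le_trans qy.
  by apply: le_multiple bq; have [] := lP _ Db.
have lk b : D b -> (l b <= max_mult y b)%N.
  move=> Db; have [q bq] := lb b Db.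
  by apply: max_mult_le => //; exact: (DA _ Db).1.
have disD : disjoint_family D (fun b => multiple (l b) b).
  apply: atoms_multiples_disjoint => // [a b /DB[aA ay] /DB[_ by_] _|b Db].
    exact: meager_atoms_orth yM aA ay by_.
  by rewrite (leq_trans (lk b Db)) // ltnW // meager_max_mult_lt //; exact: DA.
have [_ yL] := (orthosum_disjointP y disD).1 DE.
(* An atom that can be added to every term would give y <= y - a. *)
have all_in a : atoms_below y a -> ~ (forall b q, D b ->
    multiple (l b) b = Some q -> exists2 r, oplus a q = Some r & r <= y).
  move=> [aA ay] H; apply: aA.1; apply: le_ezero.
  have yy : y <= ominus y a.
    apply: yL => q [b Db bq]; have [r aq ry] := H _ _ Db bq.
    by rewrite -(oplus_leE aq ay).
  have := ominusP ay; rewrite oplusC => yay.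
  by rewrite -(le_oplus2l yay (oplusx0 _)).
have other a b q : atoms_below y a -> D b -> a <> b ->
    multiple (l b) b = Some q -> exists2 r, oplus a q = Some r & r <= y.
  move=> [aA ay] Db ab bq; have [bA b_y] := DB _ Db.
  have ba0 : b `&` a = ezero by apply: atoms_disjoint => // ba; exact: ab.
  have bac : b <= a^c by exact: meager_atoms_orth yM aA ay b_y.
  have [/le_orthosupplement aqc qa0] := multiple_orth ba0 bac bq.
  have [r ar] := oplus_def aqc; exists r => //.
  apply: disjoint_oplus_le ar ay _; first by rewrite meetC.
  by have [q'] := lb b Db; rewrite bq => -[->].
have DE' : D = atoms_below y.
  apply/seteqP; split=> // a aB; apply: contrapT => aD; apply: (all_in a aB).
  by move=> b q Db; apply: other => // ab; apply: aD; rewrite ab.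
split=> // a aB; apply/eqP; rewrite eqn_leq lk ?DE' // leqNgt; apply/negP => lt.
apply: (all_in a aB) => b q Db bq.
have [ab|/(other _ _ _ aB Db)] := pselect (a = b); last exact.
subst b; have [[w kw wy] _] := max_multP E_archimedean y aB.1.1.
have [r] := multiple_le lt kw.
by rewrite multipleS bq /= => ar rw; exists r => //; exact: le_trans rw wy.
Qed.

End AtomicArchimedean.

(** * Sharp cores and hulls *)

Lemma eq_values (I : Type) (D : set I) (F G : I -> option E) :
  (forall i, D i -> F i = G i) -> values D F = values D G.
Proof.
by move=> FG; apply/seteqP; split=> u [i Di Fi]; exists i => //;
  rewrite -Fi FG.
Qed.

(** A sharp u below x - s gives a sharp s + u below x, so s + u <= s. *)
Lemma meager_ominus_core x : sharply_dominating E ->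
  meager (ominus x (sharp_core x)).
Proof.
move=> sdE u uS uy; have [[sS sx] sG] := sharp_coreP sdE x.
have sy := ominusP sx; set s := sharp_core x in sS sx sG sy uy *.
have [r su] : {r | oplus s u = Some r}.
  apply: oplus_def; apply: le_orthosupplement; rewrite (le_trans uy) //.
  by rewrite -oplus_defE oplusC sy.
apply: le_ezero; rewrite -(le_oplus2l su (oplusx0 s)).
apply: sG; split; first exact: sharp_oplus su.
by rewrite /= (oplus_leE su sx).
Qed.

(** Such an r is orthogonal to s and to x - s, hence to their join x.  Its
    complement is then a sharp element above x, hence above the hull and above
    r. *)
Lemma hull_ominus_core_min x r : sharply_dominating E -> sharp r ->
  r <= ominus (sharp_hull x) (sharp_core x) ->
  ominus x (sharp_core x) <= r^c -> r = ezero.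
Proof.
move=> sdE rS rt yr.
have [[sS sx] _] := sharp_coreP sdE x; have [[hS xh] hL] := sharp_hullP sdE x.
have sy := ominusP sx; have sh := le_trans sx xh; have st := ominusP sh.
have sr : sharp_core x <= r^c.
  apply: le_orthosupplement; rewrite (le_trans rt) //.
  by rewrite -oplus_defE oplusC st.
have sy0 : sharp_core x `&` ominus x (sharp_core x) = ezero.
  by apply: sharp_disjoint sS (lexx _) _; rewrite -oplus_defE oplusC sy.
have hr : sharp_hull x <= r^c.
  apply: hL; split; first exact: sharp_orthosupplement.
  exact: disjoint_oplus_le sy0 sy sr yr.
rewrite -[LHS]meetxx; apply: (sharp_disjoint rS (lexx r)).
by rewrite (le_trans rt) // (le_trans _ hr) ?ominus_le.
Qed.

End Lattice.

Theorem theorem2p17 (d : Order.disp_t) (E : latticeEffectAlgType d)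
    (E_sharply_dominating : sharply_dominating E)
    (E_atomic : atomic E) (E_archimedean : archimedean E)
    (x : E) (x_neq0 : x <> ezero) :
  let x_core := Some (sharp_core x) in
  let x_hull := Some (sharp_hull x) in
  let A : set E := [set a | atom a /\ a <= ominus x (sharp_core x)] in
  let k : E -> nat := max_mult x in
  let n : E -> nat := @fin_ord d E in
  let ka (a : E) := multiple (k a) a in
  let na (a : E) := multiple (n a) a in
  let nka (a : E) := multiple (n a - k a)%N a in
  (atomic_decomposition x A k /\
   (forall (B : set E) (l : E -> nat), atomic_decomposition x B l ->
      B = A /\ forall a, A a -> l a = k a)) /\
  (Some x = x_core ⊕ bigjoin A ka /\
   Some x = ea_join x_core (bigjoin A ka)) /\
  (Some ezero = ea_meet x_core (bigjoin A ka) /\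
   Some ezero = ea_meet x_core (orthosum A ka)) /\
  ((A !=set0 -> x_hull = bigjoin A (fun a => x_core ⊕ na a)) /\
   x_hull = x_core ⊕ bigjoin A na /\
   x_hull = x_core ⊕ orthosum A na /\
   x_hull = ea_join x_core (bigjoin A na)) /\
  (Some ezero = ea_meet x_core (bigjoin A na) /\
   Some ezero = ea_meet x_core (orthosum A na)) /\
  (x_hull = Some x ⊕ orthosum A nka /\
   x_hull = Some x ⊕ bigjoin A nka).
Proof.
move=> x_core x_hull A k n ka na nka.
have [[sS sx] _] := sharp_coreP E_sharply_dominating x.
have [[hS xh] _] := sharp_hullP E_sharply_dominating x.
have yM := meager_ominus_core (x := x) E_sharply_dominating.
have tmin r := @hull_ominus_core_min _ _ x r E_sharply_dominating.
have sh := le_trans sx xh.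
have sy := ominusP sx; have st := ominusP sh.
have tS := sharp_ominus sS hS sh.
have sdis z r : oplus (sharp_core x) z = Some r ->
    Order.meet (sharp_core x) z = ezero.
  move=> sz; apply: sharp_disjoint sS (lexx _) _.
  by rewrite -oplus_defE oplusC sz.
have AE : A = atoms_below (ominus x (sharp_core x)) by [].
clearbody A; subst A; set A := atoms_below _.
set s := sharp_core x in x_core sS sx sh sy st tS sdis yM tmin A *.
set h := sharp_hull x in x_hull hS xh sh st tS tmin *.
set y := ominus x s in sy yM tmin A *; set t := ominus h s in st tS tmin *.
have yt : y <= t by rewrite -(le_oplus2l sy st).
(* The statement measures multiplicities in x, the lemmas measure them in y. *)
have kE a : A a -> k a = max_mult y a.
  by case=> aA ay; exact: max_mult_oplus_sharp sy aA ay.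
have kn a : A a -> (k a < n a)%N.
  by move=> Aa; rewrite kE //; apply: meager_max_mult_lt => //; case: Aa.
have kF : disjoint_family A ka.
  by apply: meager_multiples_disjoint => // a /kn/ltnW.
have nF : disjoint_family A na by apply: meager_multiples_disjoint.
have nkF : disjoint_family A nka.
  by apply: meager_multiples_disjoint => // a _; exact: leq_subr.
have kL : isLub (values A ka) y.
  rewrite (@eq_values _ _ _ _ _ (fun a => multiple (max_mult y a) a)).
    exact: lub_max_mult.
  by move=> a Aa; rewrite /ka kE.
have nL : isLub (values A na) t by apply: lub_fin_ord.
have nkL : isLub (values A nka) (ominus t y).
  rewrite (@eq_values _ _ _ _ _ (fun a => multiple (n a - max_mult y a)%N a)).
    exact: lub_complement.
  by move=> a Aa; rewrite /nka kE.
have xw : oplus x (ominus t y) = Some h.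
  have [u su uw] := oplusAl (ominusP yt) st.
  by move: su; rewrite sy => -[->].
have [kO kJ] := ((orthosum_disjointP y kF).2 kL, bigjoin_lub kF.1 kL).
have [nO nJ] := ((orthosum_disjointP t nF).2 nL, bigjoin_lub nF.1 nL).
have [nkO nkJ] :=
  ((orthosum_disjointP _ nkF).2 nkL, bigjoin_lub nkF.1 nkL).
rewrite kO kJ nO nJ nkO nkJ /= sy st xw (sdis _ _ sy) (sdis _ _ st).
rewrite -(disjoint_oplusE (sdis _ _ sy) sy) -(disjoint_oplusE (sdis _ _ st) st).
split; last first.
  by repeat split=> //; move=> A0; apply/esym/(oplus_bigjoin A0 st nF.1 nL).
split.
  split=> [a []//|a Aa|]; last by rewrite kO /= sy.
  rewrite ord_fin //; last by case: Aa => -[].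
  split; first by rewrite kE //; apply: max_mult_gt0 => //; case: Aa => -[].
  by move=> [kn']; have := kn a Aa; rewrite kn' ltnn.
move=> B l [BA lP]; rewrite -/s; case e: orthosum => [z|] //= /esym sz.
have [] := meager_sum_unique E_archimedean yM BA lP _; last first.
  by move=> BE lk; split=> // a Aa; rewrite lk // kE.
by rewrite e (oplusI sz sy).
Qed.
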